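(* Let $K$ be a field, let $n\geq m\geq 3$, let $G_1$ be the complete graph on $[m]$ and $G_2$ the cycle on $[n]$. Then $J_{G_1,G_2}$ is unmixed if and only if $m=n=3$, or $n=4$ and $m=3$, or $n=5$ and $m=3$.
   Context: $[m]=\{1,\ldots,m\}$. $X=(x_{ij})$ is an $m\times n$ matrix of indeterminates, $K[X]$ the polynomial ring in its entries. For $e=\{i,j\}$ with $1\le i<j\le m$ and $f=\{k,l\}$ with $1\le k<l\le n$ put $p_{e,f}=x_{ik}x_{jl}-x_{il}x_{jk}$, and $J_{G_1,G_2}=(p_{e,f}: e\in E(G_1), f\in E(G_2))\subset K[X]$ is the binomial edge ideal of the pair $(G_1,G_2)$. An ideal is unmixed if all its associated primes have the same height. *)

(* Defs.v *)
From HB Require Import structures.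
From mathcomp Require Import all_boot all_order all_algebra.
From mathcomp Require Import ring_quotient.
From mathcomp Require Import boolp.
From mathcomp Require Import mpoly.

Set Implicit Arguments.
Unset Strict Implicit.
Unset Printing Implicit Defensive.

Import GRing.Theory.
Local Open Scope ring_scope.

Section Ideals.
Variable R : comNzRingType.

(* Membership predicates are boolean, as in ring_quotient; by [asbool] every
   subset of R is of this form, so no ideal is left out. *)
Definition generated_ideal (I : finType) (A : pred I) (F : I -> R) : {pred R} :=
  fun g => `[< exists c : I -> R, g = \sum_(i | A i) c i * F i >].

(* [idealr_closed] includes properness. *)
Definition prime_ideal (P : {pred R}) : Prop :=
  idealr_closed P /\ prime_idealr_closed P.

(* P = (I : f), the annihilator of the class of f in R/I. *)
Definition associated_prime (I P : {pred R}) : Prop :=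
  prime_ideal P /\ exists f : R, forall g : R, (g \in P) = (g * f \in I).

Definition strict_subset (P Q : {pred R}) : Prop :=
  {subset P <= Q} /\ ~ {subset Q <= P}.

(* Only C 0, ..., C h matter. *)
Definition prime_chain_to (P : {pred R}) (h : nat) (C : nat -> {pred R}) : Prop :=
  [/\ forall i, (i <= h)%N -> prime_ideal (C i),
      forall i, (i < h)%N -> strict_subset (C i) (C i.+1)
    & C h =i P].

Definition has_height (P : {pred R}) (h : nat) : Prop :=
  (exists C, prime_chain_to P h C) /\
  (forall h' C, prime_chain_to P h' C -> (h' <= h)%N).

(* A prime with arbitrarily long chains below it has no natural number as
   height; with P and Q playing symmetric roles, the condition says that the
   heights agree in N together with infinity. *)
Definition unmixed (I : {pred R}) : Prop :=
  forall P Q : {pred R}, associated_prime I P -> associated_prime I Q ->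
  forall h : nat, has_height P h -> has_height Q h.

End Ideals.

(* A simple graph on [n] is given by its adjacency relation on 'I_n; the vertex
   i of [n] is the element i - 1 of 'I_n. *)
Definition complete_graph (n : nat) : rel 'I_n := fun i j => i != j.

(* [ordS] is the cyclic successor; this is an irreflexive relation, i.e. a simple
   graph, for n >= 2, and the n-cycle for n >= 3. *)
Definition cycle_graph (n : nat) : rel 'I_n :=
  fun k l => (l == ordS k) || (k == ordS l).

Section BinomialEdgeIdeal.
Variables (K : fieldType) (m n : nat).

Definition indet_mx : 'M[{mpoly K[m * n]}]_(m, n) :=
  \matrix_(i, j) 'X_(mxvec_index i j).

(* Row vertices e = {e.1 < e.2}, column vertices f = {f.1 < f.2}. *)
Definition minor2 (ef : ('I_m * 'I_m) * ('I_n * 'I_n)) : {mpoly K[m * n]} :=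
  let: (e, f) := ef in
  indet_mx e.1 f.1 * indet_mx e.2 f.2 - indet_mx e.1 f.2 * indet_mx e.2 f.1.

Definition is_edge (p : nat) (G : rel 'I_p) (e : 'I_p * 'I_p) : bool :=
  (e.1 < e.2)%N && G e.1 e.2.

Definition binomial_edge_ideal (G1 : rel 'I_m) (G2 : rel 'I_n) :
    {pred {mpoly K[m * n]}} :=
  generated_ideal (fun ef => is_edge G1 ef.1 && is_edge G2 ef.2) minor2.

End BinomialEdgeIdeal.

Arguments complete_graph n : clear implicits.
Arguments cycle_graph n : clear implicits.
Arguments binomial_edge_ideal K {m n} G1 G2.

(* Main.v *)
Require Import Defs.
From mathcomp Require Import all_boot all_order all_algebra.
From mathcomp Require Import ring_quotient boolp.
From mathcomp Require Import mpoly zify.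

(* For a set S of columns let P_S be the kernel of the map sending x_ij to 0 if j
   is in S, and to y_(i,c) t_j otherwise, where c is the component of j in G_2
   deprived of S. Two monomials are congruent modulo J iff they have the same
   column degrees and the same row contents in each component of the graph of
   their nonempty columns, because entries can be exchanged along paths of
   nonempty columns; hence J is the intersection of all the P_S. It follows that
   the associated primes are the P_S for which every s in S has two neighbours in
   different components of the graph deprived of S. With c(S) components, P_S has
   height mn - (n - |S|) - (m - 1) c(S): an explicit chain of kernels gives one
   inequality; for the other, each step down in a chain of primes increases the
   number of algebraically independent elements.
   For a cycle and a nonempty cut set S, 2 <= c(S) <= |S| <= n/2. If J is unmixed,
   comparing P_S with P_{} gives (m - 1)(c(S) - 1) = |S|, which is impossible for
   |S| = 2 unless m = 3, and for |S| = 3 and m = 3. If n <= 5, then |S| = c(S) = 2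
   for every nonempty cut set S, so that all heights agree. *)

Set Implicit Arguments.
Unset Strict Implicit.
Unset Printing Implicit Defensive.

Import GRing.Theory.

(** * Ring morphisms out of polynomial rings *)

Section MpolyMorphisms.
Local Open Scope ring_scope.
Variables (n : nat) (K : comNzRingType).

Lemma mpoly_morph_ext (A : nzRingType) (f g : {rmorphism {mpoly K[n]} -> A}) :
  (forall c, f c%:MP = g c%:MP) -> (forall i, f 'X_i = g 'X_i) -> f =1 g.
Proof.
move=> fgC fgX p; rewrite [p]mpolyE !rmorph_sum; apply: eq_bigr => u _.
rewrite -mul_mpolyC !rmorphM fgC mpolyXE_id !rmorph_prod; congr (_ * _).
by apply: eq_bigr => i _; rewrite !rmorphXn fgX.
Qed.

Lemma eq_mmap (A : nzRingType) (f f' : K -> A) (h h' : 'I_n -> A)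
    (p : {mpoly K[n]}) :
  f =1 f' -> h =1 h' -> mmap f h p = mmap f' h' p.
Proof. by move=> ff' hh'; apply: eq_bigr => u _; rewrite ff' (mmap1_eq _ hh'). Qed.

Lemma mmap_comp (A B : comNzRingType) (f : {rmorphism K -> A})
    (g : {rmorphism A -> B}) (h : 'I_n -> A) (p : {mpoly K[n]}) :
  g (mmap f h p) = mmap (g \o f) (g \o h) p.
Proof.
rewrite /mmap rmorph_sum; apply: eq_bigr => u _ /=.
rewrite rmorphM rmorph_prod; congr (_ * _).
by apply: eq_bigr => i _; rewrite rmorphXn.
Qed.

End MpolyMorphisms.

(** * Prime ideals, kernels and heights *)

Section PrimeIdeals.
Local Open Scope ring_scope.

Definition morph_kernel (A B : comNzRingType) (f : A -> B) : {pred A} :=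
  fun g => f g == 0.

Lemma morph_kernelE (A B : comNzRingType) (f : A -> B) g :
  (g \in morph_kernel f) = (f g == 0).
Proof. by []. Qed.

Lemma prime_morph_kernel (A : comNzRingType) (B : idomainType)
    (f : {rmorphism A -> B}) : prime_ideal (morph_kernel f).
Proof.
split=> [|u v]; last by rewrite !morph_kernelE rmorphM mulf_eq0.
split=> [||a u v]; rewrite !morph_kernelE ?rmorph0 ?eqxx ?rmorph1 ?oner_eq0 //.
by move=> /eqP u0 /eqP v0; rewrite rmorphD rmorphM u0 v0 mulr0 addr0.
Qed.

Variable R : comNzRingType.
Implicit Types P Q : {pred R}.

Lemma ideal0 P : idealr_closed P -> 0 \in P.
Proof. by case. Qed.

Lemma idealMl P a u : idealr_closed P -> u \in P -> a * u \in P.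
Proof. by case=> P0 _ PD uP; rewrite -[_ * _]addr0 PD. Qed.

Lemma idealD P u v : idealr_closed P -> u \in P -> v \in P -> u + v \in P.
Proof. by case=> P0 _ PD uP vP; rewrite -[u]mul1r PD. Qed.

Lemma idealB P u v : idealr_closed P -> u \in P -> v \in P -> u - v \in P.
Proof. by case=> P0 _ PD uP vP; rewrite addrC -mulN1r PD. Qed.

Lemma prime_idealM P u v :
  prime_ideal P -> (u * v \in P) = (u \in P) || (v \in P).
Proof.
move=> [idlP prP]; apply/idP/orP => [uvP|[uP|vP]]; first by apply/orP/prP.
  by rewrite mulrC idealMl.
exact: idealMl.
Qed.

Lemma prime_ideal_prod P (I : Type) (r : seq I) (D : pred I) (F : I -> R) :
  prime_ideal P -> (forall i, D i -> F i \notin P) ->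
  \prod_(i <- r | D i) F i \notin P.
Proof.
move=> prP FP; elim/big_rec: _ => [|i x /FP Fi xP]; first by case: prP => [[]].
by rewrite prime_idealM // negb_or Fi xP.
Qed.

Lemma has_height_unique P h1 h2 : has_height P h1 -> has_height P h2 -> h1 = h2.
Proof.
move=> [[C1 c1] m1] [[C2 c2] m2]; apply/eqP; rewrite eqn_leq.
by rewrite (m2 _ _ c1) (m1 _ _ c2).
Qed.

Lemma eq_has_height P Q h : P =i Q -> has_height P h -> has_height Q h.
Proof.
move=> PQ [[C [Cp Cs Ce]] mx]; split.
  by exists C; split=> // g; rewrite Ce PQ.
by move=> h' C' [Cp' Cs' Ce']; apply: (mx h' C'); split=> // g; rewrite Ce' PQ.
Qed.

End PrimeIdeals.

(** * Algebraic independence and the upper bound for heights *)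

Section AlgebraicIndependence.
Local Open Scope ring_scope.
Variables (K : fieldType) (N : nat).
Local Notation R := {mpoly K[N]}.
Implicit Types (P Q : {pred R}).

(** Algebraic independence over K of the residue classes modulo [P]; for [pred1 0], independence in
    the polynomial ring itself. *)
Definition alg_indep_mod P d (F : 'I_d -> R) : Prop :=
  forall g : {mpoly K[d]}, mmap (@mpolyC N K) F g \in P -> g = 0.

(** Widening the coefficients and evaluating at the last variable undoes [muni]. *)
Lemma muni_inj d : injective (@muni d K).
Proof.
move=> p q; pose f := horner_eval 'X_ord_max \o map_poly (@mwiden d K) \o @muni d K.
have fE r : f r = r.
  apply: (@mpoly_morph_ext _ _ _ f idfun) => [c|i] /=.
    by rewrite muniC map_polyC /= mwidenC /horner_eval hornerC.
  rewrite /muni mmapX mmap1U; case: splitP => j /= ij.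
    rewrite map_polyC /= mwidenX mnmwiden1 /horner_eval hornerC.
    by congr 'X_[U_(_)]; apply/val_inj.
  rewrite map_polyX /horner_eval hornerX; congr 'X_[U_(_)].
  by apply/val_inj; rewrite /= ij ord1 addn0.
by move=> pq; rewrite -(fE p) -(fE q) /f /= pq.
Qed.

Definition ord_snoc (T : Type) d (F : 'I_d -> T) (x : T) : 'I_d.+1 -> T :=
  fun i => if unlift ord_max i is Some j then F j else x.

Lemma mmap_snoc d (F : 'I_d -> R) (x : R) (g : {mpoly K[d.+1]}) :
  mmap (@mpolyC N K) (ord_snoc F x) g =
  (map_poly (mmap (@mpolyC N K) F) (muni g)).[x].
Proof.
pose f := horner_eval x \o map_poly (mmap (@mpolyC N K) F) \o @muni d K.
apply: (@mpoly_morph_ext _ _ _ (mmap (@mpolyC N K) (ord_snoc F x)) f) => [c|i] /=.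
  by rewrite mmapC muniC map_polyC /= mmapC /horner_eval hornerC.
rewrite mmapX mmap1U /muni mmapX mmap1U /ord_snoc; case: splitP => j /= ij.
  have -> : i = lift ord_max j.
    by apply/val_inj; rewrite /= ij /bump leqNgt ltn_ord.
  by rewrite liftK map_polyC /= mmapX mmap1U /horner_eval hornerC.
have -> : i = ord_max by apply/val_inj; rewrite /= ij ord1 addn0.
by rewrite unlift_none map_polyX /horner_eval hornerX.
Qed.

(* Reading a relation modulo P from its constant term in x upwards: x lies in Q,
   so the constant term vanishes, and x is not in P, so x can be cancelled. *)
Lemma alg_indep_mod_snoc P Q d (F : 'I_d -> R) (x : R) :
  prime_ideal P -> idealr_closed Q -> {subset P <= Q} -> x \in Q -> x \notin P ->
  alg_indep_mod Q F -> alg_indep_mod P (ord_snoc F x).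
Proof.
move=> prP idQ PQ xQ xP indF g; rewrite mmap_snoc => gP.
apply: muni_inj; rewrite raddf0; move: (muni g) gP => q {g}.
elim/poly_ind: q => // q c IHq; rewrite rmorphD rmorphM /= map_polyX map_polyC.
rewrite hornerD hornerMX hornerC => qcP.
have c0 : c = 0.
  apply: indF; have /(idealB idQ (PQ _ qcP)) := idealMl (map_poly (mmap (@mpolyC N K) F) q).[x] idQ xQ.
  by rewrite addrAC subrr add0r.
rewrite c0 raddf0 addr0 prime_idealM // (negPf xP) orbF in qcP *; move: qcP.
by move=> /IHq ->; rewrite mul0r raddf0 addr0.
Qed.

Lemma alg_indep_mod_sub P Q d (F : 'I_d -> R) :
  {subset P <= Q} -> alg_indep_mod Q F -> alg_indep_mod P F.
Proof. by move=> PQ indF g /PQ; apply: indF. Qed.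

Lemma msize_prod_le (I : Type) (r : seq I) (p : I -> R) (a : I -> nat) :
  (forall i, msize (p i) <= (a i).+1)%N ->
  (msize (\prod_(i <- r) p i) <= (\sum_(i <- r) a i).+1)%N.
Proof.
move=> pa; elim: r => [|i r IHr]; first by rewrite !big_nil msize1.
rewrite !big_cons; have [->|nz_p] := eqVneq (p i) 0; first by rewrite mul0r msize0.
have [->|nz_q] := eqVneq (\prod_(j <- r) p j) 0; first by rewrite mulr0 msize0.
rewrite msizeM ?mulf_neq0 // -subn1 leq_subLR add1n -addSn -addnS.
exact: leq_add.
Qed.

Lemma mcoeff_big_exponent (p : R) (E : nat) (u : 'X_{1..N}) (i : 'I_N) :
  (msize p <= E)%N -> (E <= u i)%N -> p@_u = 0.
Proof.
move=> pE Eu; apply: memN_msupp_eq0; apply: contraL (leq_trans pE Eu) => up.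
rewrite -ltnNge (leq_ltn_trans _ (msize_mdeg_lt up)) // mdegE.
by rewrite (bigD1 i) //= leq_addr.
Qed.

(* Dimension count: the D ^ d monomials with exponents < D in F_1, ..., F_d lie
   in a space of dimension at most (D * C) ^ N, with C independent of D. *)
Lemma alg_indep_leq d (F : 'I_d -> R) : alg_indep_mod (pred1 0) F -> (d <= N)%N.
Proof.
move=> indF; rewrite leqNgt; apply/negP => ltNd.
pose e := (\max_i msize (F i))%N.
(* Exponents below [D] give degree at most D d e < [E], and D > C ^ N yields E ^ N < D ^ (N + 1) <=
   D ^ d. *)
pose C := (d * e).+1; pose D := (C ^ N).+1; pose E := (D * C)%N.
pose mon k l (a : {ffun 'I_k -> 'I_l}) : 'X_{1..k} := [multinom (a i : nat) | i < k].
have mon_inj k l : injective (@mon k l).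
  by move=> a a' /mnmP aa; apply/ffunP => i; apply/val_inj; have := aa i; rewrite !mnmE.
pose I := {ffun 'I_d -> 'I_D}; pose I' := {ffun 'I_N -> 'I_E}.
pose A := \matrix_(i < #|{: I}|, j < #|{: I'}|)
  (mmap1 F (mon _ _ (enum_val i)))@_(mon _ _ (enum_val j)).
have ltI : (#|{: I'}| < #|{: I}|)%N.
  rewrite !card_ffun !card_ord expnMn.
  apply: leq_trans (_ : D ^ N.+1 <= _)%N; last by rewrite leq_pexp2l.
  by rewrite expnSr ltn_pmul2l ?expn_gt0.
(* [A] has more rows than columns; a nonzero vector of its left kernel holds the coefficients of a
   relation [g]. *)
have : kermx A != 0.
  by rewrite -mxrank_eq0 mxrank_ker subn_eq0 -ltnNge (leq_ltn_trans (rank_leq_col _)).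
case/rowV0Pn => v /sub_kermxP vA v0.
pose g : {mpoly K[d]} := \sum_i v 0 i *: 'X_[mon _ _ (enum_val i)].
have g_coef i : g@_(mon _ _ (enum_val i)) = v 0 i.
  rewrite raddf_sum (bigD1 i) //= mcoeffZ mcoeffX eqxx mulr1 big1 ?addr0 // => j ji.
  by rewrite mcoeffZ mcoeffX (inj_eq (@mon_inj _ _)) (inj_eq enum_val_inj) (negPf ji) mulr0.
have Fle i : (msize (F i) <= e.+1)%N.
  by rewrite leqW // /e (bigmax_sup i).
have F_size (a : I) : (msize (mmap1 F (mon _ _ a)) <= E)%N.
  have FX i k : (msize (F i ^+ k) <= (k * e).+1)%N.
    rewrite -[k in F i ^+ k]card_ord -prodr_const -big_enum /=.
    apply: leq_trans (msize_prod_le _ (fun=> Fle i)) _.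
    by rewrite big_const_seq count_predT -cardE card_ord iter_addn_0 mulnC.
  apply: leq_trans (msize_prod_le _ (fun i => FX i (mon _ _ a i))) _.
  rewrite /E /C mulnS.
  apply: leq_ltn_trans (_ : \sum_(i < d) D * e < _)%N.
    by apply: leq_sum => i _; rewrite leq_mul2r mnmE orbC ltnW.
  by rewrite sum_nat_const card_ord mulnCA -[X in (X < _)%N]add0n ltn_add2r.
have gF : mmap (@mpolyC N K) F g = 0.
  have -> : mmap (@mpolyC N K) F g = \sum_i v 0 i *: mmap1 F (mon _ _ (enum_val i)).
    by rewrite raddf_sum; apply: eq_bigr => i _ /=; rewrite mmapZ mmapX mul_mpolyC.
  apply/mpolyP => u; rewrite mcoeff0 raddf_sum /=.
  have [/existsP[i Eu]|] := boolP [exists i, (E <= u i)%N].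
    by rewrite big1 // => k _; rewrite mcoeffZ (mcoeff_big_exponent (F_size _) Eu) mulr0.
  rewrite negb_exists => /forallP uE.
  have uE' i : (u i < E)%N by rewrite ltnNge uE.
  pose a : I' := [ffun i => Ordinal (uE' i)].
  have -> : u = mon _ _ (enum_val (enum_rank a)).
    by apply/mnmP => i; rewrite enum_rankK mnmE ffunE.
  transitivity ((v *m A) 0 (enum_rank a)); last by rewrite vA mxE.
  by rewrite mxE; apply: eq_bigr => i _; rewrite mcoeffZ mxE.
have g0 : g = 0 by apply: indF; rewrite inE gF.
case/eqP: v0; apply/rowP => i; rewrite mxE -g_coef g0 mcoeff0 //.
Qed.

(** Induction on h: an element of [C h.+1] outside [C h] extends the independent family on passing
    down to [C h]. At the bottom of the chain at most N elements are independent. *)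
Lemma prime_chain_leq P h C d (F : 'I_d -> R) :
  prime_chain_to P h C -> alg_indep_mod P F -> (h + d <= N)%N.
Proof.
elim: h P d F => [|h IHh] P d F [Cp Cs Ce] indF.
  apply: (@alg_indep_leq _ F); apply: alg_indep_mod_sub indF => g.
  by rewrite inE => /eqP ->; rewrite -Ce; apply/ideal0; case: (Cp 0%N).
have [subC nsubC] := Cs h (ltnSn h).
have [x xC xCh] : exists2 x, x \in C h.+1 & x \notin C h.
  apply: contrapT => nex; apply: nsubC => x xC.
  by apply: contrapT => /negP xCh; apply: nex; exists x.
rewrite addSnnS; apply: (IHh (C h) _ (ord_snoc F x)).
  by split=> // i ih; [apply/Cp/ltnW|apply/Cs/ltnW].
apply: (@alg_indep_mod_snoc _ (C h.+1)) => //; [exact: Cp|by case: (Cp h.+1)|].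
by move=> g; rewrite Ce; apply: indF.
Qed.

End AlgebraicIndependence.

Lemma inj_mxvec_index (m n : nat) (i i' : 'I_m) (j j' : 'I_n) :
  (mxvec_index i j == mxvec_index i' j') = ((i, j) == (i', j')).
Proof.
apply/eqP/eqP => [eq_ij|[-> ->] //]; pose A := (\matrix_(k < m, l < n) (k, l))%R.
by have := congr1 (mxvec A 0%R) eq_ij; rewrite !mxvecE !mxE.
Qed.

Notation specialize M := (mmap (@mpolyC _ _) (fun_of_matrix (mxvec M) 0%R)).

(** * The primes P_S as kernels of specializations *)

Section ColumnSpecializations.
Local Open Scope ring_scope.
Variables (K : fieldType) (m n : nat).
Local Notation R := {mpoly K[m * n]}.
Local Notation A := {mpoly K[m * n + n]}.
Local Notation X := (indet_mx K m n).
Implicit Types (S : {set 'I_n}) (b : 'I_n -> 'I_n).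

Lemma mpolyX_neq0 N (u : 'X_{1..N}) : 'X_[K, u] != 0.
Proof.
by apply/eqP => /(congr1 (mcoeff u))/eqP; rewrite mcoeff0 mcoeffX eqxx oner_eq0.
Qed.

Lemma mpolyX_inj N : injective (@mpolyX N K).
Proof.
move=> u v /(congr1 (mcoeff u)); rewrite !mcoeffX eqxx.
by have [->|_ /eqP] := eqVneq v u; rewrite ?oner_eq0.
Qed.

Lemma indet_morph_ext (B : nzRingType) (f g : {rmorphism R -> B}) :
  (forall c, f c%:MP = g c%:MP) -> (forall i j, f (X i j) = g (X i j)) -> f =1 g.
Proof.
move=> fgC fgX; apply: mpoly_morph_ext => // k.
by case/mxvec_indexP: k => i j; have := fgX i j; rewrite mxE.
Qed.

Lemma specializeX (M : 'M[A]_(m, n)) i j : specialize M (X i j) = M i j.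
Proof. by rewrite mxE mmapX mmap1U mxvecE. Qed.

(** Components are named by representative columns, so a variable y_(i,c) is provided for every
    column c. *)
Definition yvar i j : A := 'X_(lshift n (mxvec_index i j)).
Definition tvar j : A := 'X_(rshift (m * n) j).

Definition yt_value (B : comNzRingType) (Y : 'M[B]_(m, n)) (T : 'I_n -> B)
    (k : 'I_(m * n + n)) : B :=
  match split k with inl k' => mxvec Y 0 k' | inr j => T j end.

Lemma yt_value_y (B : comNzRingType) (Y : 'M[B]_(m, n)) T i j :
  yt_value Y T (lshift n (mxvec_index i j)) = Y i j.
Proof. by rewrite /yt_value (unsplitK (inl _)) mxvecE. Qed.

Lemma yt_value_t (B : comNzRingType) (Y : 'M[B]_(m, n)) T j :
  yt_value Y T (rshift (m * n) j) = T j.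
Proof. by rewrite /yt_value (unsplitK (inr _)). Qed.

Definition comp_mx S b : 'M[A]_(m, n) :=
  \matrix_(i, j) if j \in S then 0 else yvar i (b j) * tvar j.

(* The prime written P_S in the literature, when b j is a representative of the
   connected component of j in the graph deprived of S: the rank one matrices
   are parametrized as (y_i * t_j). *)
Definition comp_ideal S b : {pred R} := morph_kernel (specialize (comp_mx S b)).

Lemma prime_comp_ideal S b : prime_ideal (comp_ideal S b).
Proof. exact: prime_morph_kernel. Qed.

(** The specialization for [S] factors through that for [S']: send t_j to 0 for j in [S] and rename
    the y's by [c], which the second hypothesis makes well defined. *)
Lemma comp_ideal_sub S S' b b' :
  S' \subset S ->
  (forall j j', j \notin S -> j' \notin S -> b' j = b' j' -> b j = b j') ->
  {subset comp_ideal S' b' <= comp_ideal S b}.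
Proof.
move=> subS b'b.
(* A label carried by no column outside [S] only occurs next to a t_j that is sent to 0, so the
   default [l] is harmless. *)
pose c l := if [pick j | (j \notin S) && (b' j == l)] is Some j then b j else l.
have cE j : j \notin S -> c (b' j) = b j.
  rewrite /c => jS; case: pickP => [j' /andP[j'S /eqP bj']|/(_ j)].
    exact: b'b.
  by rewrite jS eqxx.
pose f := mmap (@mpolyC (m * n + n) K)
  (yt_value (\matrix_(i, j) yvar i (c j)) (fun j => if j \in S then 0 else tvar j)).
have fE g : specialize (comp_mx S b) g = f (specialize (comp_mx S' b') g).
  apply: (@indet_morph_ext _ _ (f \o specialize _)) => [a|i j] /=; first by rewrite !mmapC.
  rewrite !specializeX !mxE; have [jS'|jS'] := boolP (j \in S').
    by rewrite (subsetP subS) // /f raddf0.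
  rewrite /f rmorphM /= !mmapX !mmap1U yt_value_y yt_value_t mxE.
  by case: ifP => jS; rewrite ?mulr0 // cE // jS.
by move=> g; rewrite !morph_kernelE fE => /eqP ->; rewrite /f raddf0.
Qed.

(** If both columns survive, they share a component c and both products are y_(i,c) y_(k,c) t_j t_l;
    otherwise both vanish. *)
Lemma comp_ideal_minor S b i k j l : (j \notin S -> l \notin S -> b j = b l) ->
  X i j * X k l - X i l * X k j \in comp_ideal S b.
Proof.
move=> bjl; rewrite morph_kernelE rmorphB !rmorphM /= !specializeX !mxE subr_eq0.
case: ifP => jS; case: ifP => lS; rewrite ?(mulr0, mul0r) //.
by rewrite bjl ?jS ?lS // mulrACA [tvar j * _]mulrC mulrACA.
Qed.

Lemma comp_ideal_var S b i j : (X i j \in comp_ideal S b) = (j \in S).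
Proof.
rewrite morph_kernelE specializeX mxE; case: ifP; first by rewrite eqxx.
by rewrite mulf_eq0 !(negPf (mpolyX_neq0 _)).
Qed.

End ColumnSpecializations.

Arguments comp_ideal K m {n} S b.

(** * Monomial substitutions *)

Section MonomialMaps.
Local Open Scope ring_scope.
Variables (K : fieldType) (N : nat).

Lemma mmap1_monomial d (w : 'I_d -> 'X_{1..N}) (u : 'X_{1..d}) :
  mmap1 (fun k => 'X_[K, w k]) u = 'X_[\sum_k w k *+ u k].
Proof. by rewrite /mmap1 mprodXnE. Qed.

(** Distinct monomials have distinct images, so no coefficients can cancel. *)
Lemma mmap_monomial_inj d (w : 'I_d -> 'X_{1..N}) (g : {mpoly K[d]}) :
  injective (fun u : 'X_{1..d} => \sum_k w k *+ u k)%MM ->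
  mmap (@mpolyC N K) (fun k => 'X_[w k]) g = 0 -> g = 0.
Proof.
move=> inj_w g0; apply/mpolyP => u; rewrite mcoeff0.
have := congr1 (mcoeff (\sum_k w k *+ u k)) g0; rewrite mcoeff0 => <-.
rewrite /mmap raddf_sum /=; have [ug|ug] := boolP (u \in msupp g).
  rewrite (bigD1_seq u) //= mmap1_monomial mcoeffCM mcoeffX eqxx mulr1.
  rewrite big1_seq ?addr0 // => v /andP[vu _].
  by rewrite mmap1_monomial mcoeffCM mcoeffX (inj_eq inj_w) (negPf vu) mulr0.
rewrite big1_seq ?memN_msupp_eq0 // => v /= vg.
rewrite mmap1_monomial mcoeffCM mcoeffX (inj_eq inj_w).
by case: eqP vg ug => [->->|]; rewrite ?mulr0.
Qed.

End MonomialMaps.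

(** * Height of the primes P_S *)

Section HeightOfComponentIdeals.
Local Open Scope ring_scope.
Variables (K : fieldType) (m n : nat) (i0 : 'I_m).
Local Notation R := {mpoly K[m * n]}.
Local Notation A := {mpoly K[m * n + n]}.
Local Notation X := (indet_mx K m n).
Variables (S : {set 'I_n}) (b : 'I_n -> 'I_n).
Hypothesis b_notin : forall j, j \notin S -> b j \notin S.
Hypothesis b_idem : forall j, j \notin S -> b (b j) = b j.

(** A maximal family of entries independent modulo P_S: the surviving part of row [i0], and in the
    other rows the representative columns. *)
Definition free_entries : {set 'I_m * 'I_n} :=
  [set e | (e.2 \notin S) && ((e.1 == i0) || (b e.2 == e.2))].

(** Outside [D] an entry is still a free variable. If [free_entries] lies in [D], these variables do
    not occur in the final entries, which only use y_(i, b j). *)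
Definition partial_mx (D : {set 'I_m * 'I_n}) : 'M[A]_(m, n) :=
  \matrix_(i, j) if (i, j) \in D then comp_mx K m S b i j else yvar K i j.

Lemma free_entries_comp i j : j \notin S -> (i, b j) \in free_entries.
Proof. by move=> jS; rewrite inE /= b_notin // b_idem // eqxx orbT. Qed.

(** Substituting the final value for y_e maps one specialization to the next, whence the inclusion.
    For e = (i, j) the new kernel gains x_ij if j lies in [S], and otherwise the minor on rows i,
    [i0] and columns j, [b j]. *)
Lemma partial_mx_step (D : {set _}) e : free_entries \subset D -> e \notin D ->
  strict_subset (morph_kernel (specialize (partial_mx D)))
                (morph_kernel (specialize (partial_mx (e |: D)))).
Proof.
move=> freeD eD.
have e_free : e \notin free_entries by apply: contra eD; apply: subsetP.
split.
  pose f := mmap (@mpolyC (m * n + n) K) (yt_value (\matrix_(i, j)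
     if (i, j) == e then comp_mx K m S b i j else yvar K i j) (@tvar K m n)).
  have f_comp i j : f (comp_mx K m S b i j) = comp_mx K m S b i j.
    rewrite mxE; case: ifP => jS; first by rewrite /f raddf0.
    rewrite /f rmorphM /= !mmapX !mmap1U yt_value_y yt_value_t mxE.
    by case: eqP => // ije; rewrite -ije free_entries_comp ?jS in e_free.
  have fE g : specialize (partial_mx (e |: D)) g = f (specialize (partial_mx D) g).
    apply: (@indet_morph_ext _ _ _ _ _ (f \o specialize _)) => [a|i j] /=.
      by rewrite !mmapC.
    rewrite !specializeX !mxE in_setU1; have [ije|ije] := eqVneq (i, j) e.
      by rewrite ije (negPf eD) /= /f mmapX mmap1U yt_value_y !mxE ije eqxx.
    have /= := f_comp i j; rewrite mxE; case: ((i, j) \in D) => //= _.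
    by rewrite /f mmapX mmap1U yt_value_y mxE (negPf ije).
  by move=> g; rewrite !morph_kernelE fE => /eqP ->; rewrite /f raddf0.
case: e eD e_free => i j eD e_free sub.
have [jS|jS] := boolP (j \in S).
  have := sub (X i j); rewrite !morph_kernelE !specializeX !mxE setU11 (negPf eD) jS eqxx.
  by rewrite (negPf (mpolyX_neq0 _ _)) => /(_ isT).
have [i_i0 bjj] : i != i0 /\ b j != j.
  by apply/andP; rewrite -negb_or; move: e_free; rewrite inE /= jS.
have in_free k l : (k, l) \in free_entries -> ((k, l) != (i, j)) && ((k, l) \in D).
  move=> kl; rewrite (subsetP freeD) // andbT.
  by apply: contraNneq e_free => <-.
have [/andP[ne1 in1] /andP[ne2 in2]] : 
  ((i, b j) != (i, j)) && ((i, b j) \in D) /\ ((i0, b j) != (i, j)) && ((i0, b j) \in D).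
  by split; apply/in_free/free_entries_comp.
have /andP[ne3 in3] : ((i0, j) != (i, j)) && ((i0, j) \in D).
  by apply: in_free; rewrite inE /= jS eqxx.
have := sub (X i j * X i0 (b j) - X i (b j) * X i0 j).
rewrite !morph_kernelE !rmorphB !rmorphM /= !specializeX.
rewrite !mxE setU11 !in_setU1 in1 in2 in3 !orbT (negPf eD) (negPf jS).
rewrite (negPf (b_notin jS)) b_idem // => H.
have {H} : yvar K i j * (yvar K i0 (b j) * tvar K m (b j))
   - yvar K i (b j) * tvar K m (b j) * (yvar K i0 (b j) * tvar K m j) == 0.
  by apply: H; rewrite subr_eq0 mulrACA [tvar K m j * _]mulrC mulrACA.
(* At y_ij = 0 and all other variables 1 the minor takes the value -1. *)
move=> /eqP/(congr1 (mmap idfun (yt_value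
  (\matrix_(k, l) if (k, l) == (i, j) then 0 : K else 1) (fun=> 1)))).
rewrite raddf0 rmorphB !rmorphM /= !mmapX !mmap1U !yt_value_y !yt_value_t !mxE.
rewrite eqxx (negPf ne1) (negPf ne2) mul0r !mulr1 sub0r.
by move/eqP; rewrite oppr_eq0 oner_eq0.
Qed.

(** Free entries map to monomials y_(i, b j) t_j. In rows other than [i0] the exponent of y_(i,j)
    recovers that of x_ij; the exponent of t_j then gives the one in row [i0]. *)
Lemma alg_indep_free_entries :
  alg_indep_mod (comp_ideal K m S b)
    (fun k : 'I_#|free_entries| => X (enum_val k).1 (enum_val k).2).
Proof.
move=> g; rewrite morph_kernelE mmap_comp /=.
pose w (e : 'I_m * 'I_n) : 'X_{1..m * n + n} :=
  (U_(lshift n (mxvec_index e.1 (b e.2))) + U_(rshift (m * n) e.2))%MM.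
have -> : mmap (specialize (comp_mx K m S b) \o @mpolyC (m * n) K)
    (specialize (comp_mx K m S b) \o
      (fun k : 'I_#|free_entries| => X (enum_val k).1 (enum_val k).2)) g =
  mmap (@mpolyC _ K) (fun k => 'X_[w (enum_val k)]) g.
  apply: eq_mmap => [a|k] /=; first by rewrite mmapC.
  rewrite specializeX mxE; have := enum_valP k.
  by rewrite inE => /andP[/negPf -> _]; rewrite mpolyXD.
move/eqP; apply: mmap_monomial_inj => u v uv.
have sum_eq t : (\sum_k w (enum_val k) t * u k = \sum_k w (enum_val k) t * v k)%N.
  have := congr1 (fun x : 'X_{1..m * n + n} => x t) uv; rewrite !mnm_sumE.
  by under eq_bigr do rewrite mulmnE; under [in RHS]eq_bigr do rewrite mulmnE.
have free (k : 'I_#|free_entries|) := enum_valP k.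
have sumY i c : (\sum_(k : 'I_#|free_entries| | ((enum_val k).1 == i) && (b (enum_val k).2 == c)) u k =
    \sum_(k : 'I_#|free_entries| | ((enum_val k).1 == i) && (b (enum_val k).2 == c)) v k)%N.
  rewrite big_mkcond [in RHS]big_mkcond /=; have := sum_eq (lshift n (mxvec_index i c)).
  under eq_bigr do rewrite mnmDE !mnm1E eq_lshift eq_rlshift addn0 inj_mxvec_index xpair_eqE mulnbl.
  by under [in RHS]eq_bigr do
    rewrite mnmDE !mnm1E eq_lshift eq_rlshift addn0 inj_mxvec_index xpair_eqE mulnbl.
have sumT j : (\sum_(k : 'I_#|free_entries| | (enum_val k).2 == j) u k =
    \sum_(k : 'I_#|free_entries| | (enum_val k).2 == j) v k)%N.
  rewrite big_mkcond [in RHS]big_mkcond /=; have := sum_eq (rshift (m * n) j).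
  under eq_bigr do rewrite mnmDE !mnm1E eq_lrshift eq_rshift add0n mulnbl.
  by under [in RHS]eq_bigr do rewrite mnmDE !mnm1E eq_lrshift eq_rshift add0n mulnbl.
have eq1 k : (enum_val k).1 != i0 -> u k = v k.
  move=> ki; have := sumY (enum_val k).1 (enum_val k).2.
  have kb : b (enum_val k).2 = (enum_val k).2.
    by have := free k; rewrite inE (negPf ki) => /andP[_ /eqP].
  rewrite !(big_pred1 k) // => l /=; rewrite -(inj_eq enum_val_inj) -pair_eqE /pair_eq /=;
    case: eqP => //= li; have := free l; rewrite inE li (negPf ki) => /andP[_ /eqP ->] //.
apply/mnmP => k; have [ki|] := eqVneq (enum_val k).1 i0; last exact: eq1.
have := sumT (enum_val k).2; rewrite (bigD1 k) //= [in RHS](bigD1 k) //=.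
rewrite (eq_bigr v) => [/eqP|l /andP[/eqP lk nlk]]; first by rewrite eqn_add2r => /eqP.
apply: eq1; apply: contra nlk => /eqP li.
by rewrite -(inj_eq enum_val_inj) -pair_eqE /pair_eq /= lk li ki !eqxx.
Qed.

Lemma has_height_comp_ideal : has_height (comp_ideal K m S b) #|~: free_entries|.
Proof.
have card_free : (#|~: free_entries| + #|free_entries| = m * n)%N.
  by rewrite addnC cardsC card_prod !card_ord.
split.
  (* The non-free entries are specialized one at a time; after the last one the matrix is
     [comp_mx]. *)
  pose D k := free_entries :|: [set e in take k (enum (~: free_entries))].
  exists (fun k => morph_kernel (specialize (partial_mx (D k)))); split.
  - by move=> k _; apply: prime_morph_kernel.
  - move=> k k_lt; have [e0 _] : exists e0, e0 \in ~: free_entries.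
      by apply/card_gt0P; apply: leq_ltn_trans k_lt.
    have k_lt' : (k < size (enum (~: free_entries)))%N by rewrite -cardE.
    have -> : D k.+1 = nth e0 (enum (~: free_entries)) k |: D k.
      by apply/setP => e; rewrite !inE (take_nth e0) // mem_rcons in_cons orbCA.
    apply: partial_mx_step; first exact: subsetUl.
    have ek : nth e0 (enum (~: free_entries)) k \notin free_entries.
      by rewrite -in_setC -mem_enum mem_nth.
    rewrite in_setU (negPf ek) inE /=.
    rewrite -[k in take k _](@index_uniq _ e0 _ (enum (~: free_entries))) ?enum_uniq //.
    by rewrite in_take_leq ?ltnn // ltnW // index_uniq ?enum_uniq.
  - move=> g; rewrite /comp_ideal; congr (_ \in morph_kernel (specialize _)).
    apply/matrixP => i j; rewrite mxE /D take_oversize -?cardE //.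
    by rewrite inE; case: ifP => //; rewrite inE mem_enum in_setC orbN.
move=> h C chC; rewrite -(leq_add2r #|free_entries|) card_free.
exact: prime_chain_leq chC alg_indep_free_entries.
Qed.

End HeightOfComponentIdeals.

(** * Ideals given by generators *)

Section GeneratedIdeals.
Local Open Scope ring_scope.
Variables (R : comNzRingType) (I : finType) (D : pred I) (F : I -> R).

Lemma generated_ideal_gen i : D i -> F i \in generated_ideal D F.
Proof.
move=> Di; apply/asboolP; exists (fun j => (j == i)%:R).
rewrite (bigD1 i) //= eqxx mul1r big1 ?addr0 // => j /andP[_ /negPf ->].
by rewrite mul0r.
Qed.

Lemma generated_ideal0 : 0 \in generated_ideal D F.
Proof. by apply/asboolP; exists (fun=> 0); rewrite big1 // => i _; rewrite mul0r. Qed.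

Lemma generated_idealD u v :
  u \in generated_ideal D F -> v \in generated_ideal D F ->
  u + v \in generated_ideal D F.
Proof.
move=> /asboolP[c ->] /asboolP[d ->]; apply/asboolP; exists (fun i => c i + d i).
by rewrite -big_split; apply: eq_bigr => i _; rewrite mulrDl.
Qed.

Lemma generated_idealMl a u :
  u \in generated_ideal D F -> a * u \in generated_ideal D F.
Proof.
move=> /asboolP[c ->]; apply/asboolP; exists (fun i => a * c i).
by rewrite mulr_sumr; apply: eq_bigr => i _; rewrite mulrA.
Qed.

Lemma generated_idealN u : u \in generated_ideal D F -> - u \in generated_ideal D F.
Proof. by rewrite -mulN1r; apply: generated_idealMl. Qed.

Lemma generated_ideal_sum (T : Type) (r : seq T) (P : pred T) (f : T -> R) :
  (forall t, P t -> f t \in generated_ideal D F) ->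
  \sum_(t <- r | P t) f t \in generated_ideal D F.
Proof.
move=> fD; elim/big_rec: _ => [|t x Pt]; first exact: generated_ideal0.
by apply: generated_idealD; apply: fD.
Qed.

Lemma generated_ideal_sub (P : {pred R}) :
  idealr_closed P -> (forall i, D i -> F i \in P) ->
  {subset generated_ideal D F <= P}.
Proof.
move=> idP FP g /asboolP[c ->]; elim/big_rec: _ => [|i x Di]; first exact: ideal0.
by apply: idealD => //; apply: idealMl => //; apply: FP.
Qed.

End GeneratedIdeals.

Ltac ac_mnm := apply/mnmP => ?; rewrite !mnmDE; lia.

(** * Grouping monomials into classes *)

Section MonomialClasses.
Local Open Scope ring_scope.
Variables (K : fieldType) (N : nat) (T : eqType).
Variable key : 'X_{1..N} -> T.

(** [r] picks the first monomial of each class in the support. Subtracting the sum of the g_u X^(r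
    u) changes nothing: its coefficient at a representative is the sum over a whole class. *)
Lemma sum_monomial_classes (g : {mpoly K[N]}) :
  (forall u, \sum_(v <- msupp g | key v == key u) g@_v = 0) ->
  exists r : 'X_{1..N} -> 'X_{1..N}, (forall u, u \in msupp g -> key (r u) = key u) /\
    g = \sum_(u <- msupp g) g@_u *: ('X_[u] - 'X_[r u]).
Proof.
move=> g0; pose r u := nth u (msupp g) (find (fun v => key v == key u) (msupp g)).
have has_r u : u \in msupp g -> has (fun v => key v == key u) (msupp g).
  by move=> ug; apply/hasP; exists u.
have key_r u : u \in msupp g -> key (r u) = key u.
  by move=> /has_r/(nth_find u)/eqP.
have eq_r u v : u \in msupp g -> v \in msupp g -> (r u == r v) = (key u == key v).
  move=> ug vg; apply/eqP/eqP => [ruv|kuv]; first by rewrite -key_r // ruv key_r.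
  rewrite /r kuv; apply: set_nth_default.
  by rewrite -has_find has_r.
exists r; split=> //; rewrite [LHS]mpolyE; under [RHS]eq_bigr do rewrite scalerBr.
rewrite sumrB -[LHS]subr0; congr (_ - _); apply/esym/mpolyP => w.
rewrite mcoeff0 raddf_sum /=; under eq_bigr do rewrite mcoeffZ mcoeffX.
have [/hasP[v vg /eqP rv]|/hasPn nr] := boolP (has (fun v => r v == w) (msupp g)).
  rewrite -rv -[RHS](g0 v) [RHS]big_mkcond /=; apply: eq_big_seq => u ug.
  by rewrite eq_r //; case: ifP; rewrite ?mulr1 ?mulr0.
by rewrite big1_seq // => v /= /nr /negPf ->; rewrite mulr0.
Qed.

End MonomialClasses.

(** * Monomials modulo J, and J as an intersection of the P_S *)

Section BinomialEdgeIdealOfCompleteGraph.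
Local Open Scope ring_scope.
Variables (K : fieldType) (m n : nat) (G : rel 'I_n).
Hypotheses (G_sym : ssrbool.symmetric G) (G_irr : irreflexive G).
Local Notation R := {mpoly K[m * n]}.
Local Notation X := (indet_mx K m n).
Local Notation J := (binomial_edge_ideal K (complete_graph m) G).

Lemma binomial_edge_ideal_minor i k j l :
  G j l -> X i j * X k l - X i l * X k j \in J.
Proof.
wlog ltjl : j l / (j < l)%N => [wl|] Gjl.
  have [/wl|/wl|/val_inj eq_jl] := ltngtP j l; first exact.
    by rewrite G_sym => /(_ Gjl)/generated_idealN; rewrite opprB.
  by rewrite eq_jl G_irr in Gjl.
have [ltik|ltki|/val_inj ->] := ltngtP i k.
- apply: (@generated_ideal_gen _ _ _ _ ((i, k), (j, l))).
  by rewrite /is_edge /= ltik ltjl Gjl /complete_graph neq_ltn ltik.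
- rewrite -opprB; apply: generated_idealN.
  rewrite mulrC [X i j * _]mulrC.
  apply: (@generated_ideal_gen _ _ _ _ ((k, i), (j, l))).
  by rewrite /is_edge /= ltki ltjl Gjl /complete_graph neq_ltn ltki.
by rewrite [X k l * _]mulrC subrr; apply: generated_ideal0.
Qed.

Lemma binomial_edge_ideal_sub (S : {set 'I_n}) (b : 'I_n -> 'I_n) :
  (forall j l, j \notin S -> l \notin S -> G j l -> b j = b l) ->
  {subset J <= comp_ideal K m S b}.
Proof.
move=> bG; apply: generated_ideal_sub; first by case: (prime_comp_ideal K m S b).
move=> [e f] /andP[_ /andP[_ Gf]]; apply: comp_ideal_minor => f1 f2.
exact: bG.
Qed.

Local Notation E i j := U_(mxvec_index i j)%MM.
Implicit Types (u v w : 'X_{1..m * n}) (S : {set 'I_n}) (b : 'I_n -> 'I_n).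

Definition colsize u j : nat := (\sum_i u (mxvec_index i j))%N.
Definition rowsize b u i c : nat := (\sum_(j | b j == c) u (mxvec_index i j))%N.

Lemma colsizeD u v j : colsize (u + v)%MM j = (colsize u j + colsize v j)%N.
Proof. by rewrite /colsize -big_split; apply: eq_bigr => i _; rewrite mnmDE. Qed.

Lemma rowsizeD b u v i c :
  rowsize b (u + v)%MM i c = (rowsize b u i c + rowsize b v i c)%N.
Proof. by rewrite /rowsize -big_split; apply: eq_bigr => j _; rewrite mnmDE. Qed.

Lemma colsizeU i j l : colsize (E i j) l = (j == l).
Proof.
rewrite /colsize (bigD1 i) //= mnm1E inj_mxvec_index xpair_eqE eqxx big1 ?addn0 //.
by move=> k ki; rewrite mnm1E inj_mxvec_index xpair_eqE eq_sym (negPf ki).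
Qed.

Lemma rowsizeU b i j k c : rowsize b (E i j) k c = (i == k) && (b j == c).
Proof.
rewrite /rowsize big_mkcond (bigD1 j) //= big1 ?addn0 => [|l lj].
  by rewrite mnm1E inj_mxvec_index xpair_eqE eqxx andbT andbC; case: ifP.
by case: ifP => // _; rewrite mnm1E inj_mxvec_index xpair_eqE [j == l]eq_sym (negPf lj) andbF.
Qed.

Lemma entry_split u i j : u (mxvec_index i j) != 0%N -> exists v, u = (v + E i j)%MM.
Proof. by rewrite -lep1mP => le_u; exists (u - E i j)%MM; rewrite submK. Qed.

Lemma colsize_split u j : colsize u j != 0%N -> exists i v, u = (v + E i j)%MM.
Proof.
rewrite sum_nat_eq0 negb_forall => /existsP[i /= ui].
by have [v ->] := entry_split ui; exists i, v.
Qed.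

Lemma rowsize_split b u i c :
  rowsize b u i c != 0%N -> exists j v, b j = c /\ u = (v + E i j)%MM.
Proof.
rewrite sum_nat_eq0 negb_forall => /existsP[j]; rewrite negb_imply => /andP[/eqP bj].
by case/entry_split=> v ->; exists j, v.
Qed.

Definition mono_congr u v := 'X_[u] - 'X_[v] \in J.

Lemma mono_congr_refl u : mono_congr u u.
Proof. by rewrite /mono_congr subrr; apply: generated_ideal0. Qed.

Lemma mono_congr_trans v u w : mono_congr u v -> mono_congr v w -> mono_congr u w.
Proof.
move=> uv vw; rewrite /mono_congr.
have -> : 'X_[u] - 'X_[w] = ('X_[u] - 'X_[v]) + ('X_[v] - 'X_[w]) :> R.
  by rewrite addrA subrK.
exact: generated_idealD.
Qed.

Lemma mono_congr_sym u v : mono_congr u v -> mono_congr v u.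
Proof. by move=> /generated_idealN; rewrite opprB. Qed.

Lemma mono_congr_swap w i j k l :
  G j l -> mono_congr (w + E i j + E k l)%MM (w + E k j + E i l)%MM.
Proof.
move=> Gjl; rewrite /mono_congr !mpolyXD -!mulrA -mulrBr; apply: generated_idealMl.
by have := binomial_edge_ideal_minor i k Gjl; rewrite !mxE [in X in _ - X]mulrC.
Qed.

Definition induced S : rel 'I_n := fun j l => [&& j \notin S, l \notin S & G j l].

(* Along a path whose columns are all nonempty, the row indices at both ends can
   be exchanged through an entry of the second column of the path. *)
Lemma mono_congr_path S w i j k l p :
  path (induced S) j p -> l = last j p ->
  (forall c, c \notin S -> colsize (w + E i j + E k l)%MM c != 0%N) ->
  mono_congr (w + E i j + E k l)%MM (w + E k j + E i l)%MM.
Proof.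
elim: p => [|j1 p IHp] /= in w i j *.
  by move=> _ -> _; rewrite -addmA [(E i j + _)%MM]addmC addmA; apply: mono_congr_refl.
move=> /andP[/and3P[jS j1S Gjj1] pathp] lastp full.
(* If [w] has nothing in column j1, one of the two other entries lies there; as j1 differs from j,
   it is l, and one swap suffices. *)
have [w0|] := eqVneq (colsize w j1) 0%N.
  have := full j1 j1S; rewrite !colsizeD !colsizeU w0 add0n.
  have [jj1|_] := eqVneq j j1; first by rewrite jj1 G_irr in Gjj1.
  by have [->|//] := eqVneq l j1 => _; apply: mono_congr_swap.
(* With an entry (a, j1) at hand: swap i with a along the first edge, exchange i and k along the
   rest, then swap a with k. *)
case/colsize_split => a [w' eq_w]; rewrite {w}eq_w in full *.
have -> : (w' + E a j1 + E i j + E k l = w' + E k l + E i j + E a j1)%MM by ac_mnm.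
apply: mono_congr_trans (mono_congr_swap _ _ _ Gjj1) _.
have -> : (w' + E k l + E a j + E i j1 = w' + E a j + E i j1 + E k l)%MM by ac_mnm.
apply: mono_congr_trans (IHp _ _ _ pathp lastp _) _ => [c cS|].
  by have := full c cS; rewrite !colsizeD !colsizeU; lia.
have -> : (w' + E a j + E k j1 + E i l = w' + E i l + E a j + E k j1)%MM by ac_mnm.
apply: mono_congr_trans (mono_congr_swap _ _ _ Gjj1) _.
have -> : (w' + E i l + E k j + E a j1 = w' + E a j1 + E k j + E i l)%MM by ac_mnm.
exact: mono_congr_refl.
Qed.

(* The context w keeps the columns outside S nonempty while common entries are
   stripped from u and v. *)
Lemma mono_congr_comp S b u v w :
  (forall j l, j \notin S -> l \notin S -> b j = b l -> connect (induced S) j l) ->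
  (forall j, j \in S -> colsize u j = 0%N) ->
  (forall j, j \notin S -> colsize (u + w)%MM j != 0%N) ->
  colsize u =1 colsize v -> rowsize b u =2 rowsize b v ->
  mono_congr (u + w)%MM (v + w)%MM.
Proof.
move=> b_conn; have [d] := ubnP (mdeg u); elim: d => // d IHd in u v w *.
move=> ltud uS uw_full eqC eqR.
have [u0|] := eqVneq u 0%MM.
  have -> : v = u; last exact: mono_congr_refl.
  apply/mnmP => t; case/mxvec_indexP: t => i j; rewrite u0 mnm0E.
  have /esym/eqP := eqC j; rewrite u0 {2}/colsize big1 => [|? _]; last by rewrite mnm0E.
  by rewrite sum_nat_eq0 => /forallP/(_ i)/eqP.
move=> u_neq0; have [i [j [u' eq_u]]] : exists i j u', u = (u' + E i j)%MM.
  have /existsP[t] : [exists t, u t != 0%N].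
    rewrite -negb_forall; apply: contra u_neq0 => /forallP u0.
    by apply/eqP/mnmP => t; rewrite mnm0E; apply/eqP.
  by case/mxvec_indexP: t => i j /entry_split[u' ->]; exists i, j, u'.
have jS : j \notin S.
  by apply/negP => /uS; rewrite eq_u colsizeD colsizeU eqxx addn1.
have vS c : c \in S -> colsize v c = 0%N by move=> cS; rewrite -eqC uS.
have vw_full c : c \notin S -> colsize (v + w)%MM c != 0%N.
  by move=> cS; have := uw_full c cS; rewrite !colsizeD eqC.
(* Once both monomials contain x_ij, it moves into the context and the degree drops. *)
have step v' : colsize u =1 colsize (v' + E i j)%MM ->
    rowsize b u =2 rowsize b (v' + E i j)%MM ->
    mono_congr (u + w)%MM (v' + E i j + w)%MM.
  move=> eqC' eqR'; rewrite eq_u -!addmA; apply: IHd.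
  - by move: ltud; rewrite eq_u mdegD mdeg1 addn1.
  - by move=> c /uS; rewrite eq_u colsizeD; lia.
  - by move=> c /uw_full; rewrite eq_u -addmA.
  - by move=> c; have := eqC' c; rewrite eq_u !colsizeD; lia.
  - by move=> a c; have := eqR' a c; rewrite eq_u !rowsizeD; lia.
have [vij0|/entry_split[v' eq_v]] := eqVneq (v (mxvec_index i j)) 0%N; last first.
  by rewrite eq_v; apply: step; rewrite -?eq_v.
(* Otherwise column j of [v] has some x_kj, and row i some x_il with l in the component of j;
   exchanging their rows along a path creates x_ij. *)
have [k [v1 eq_v1]] : exists k v1, v = (v1 + E k j)%MM.
  by apply: colsize_split; rewrite -eqC eq_u colsizeD colsizeU eqxx addn1.
have [l [v2 [bl eq_v2]]] : exists l v2, b l = b j /\ v = (v2 + E i l)%MM.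
  by apply: rowsize_split; rewrite -eqR eq_u rowsizeD rowsizeU !eqxx addn1.
have lj : l != j.
  by apply: contra_eqN vij0 => /eqP <-; rewrite eq_v2 mnmDE mnm1E eqxx addn1.
have [v3 eq_v3] : exists v3, v1 = (v3 + E i l)%MM.
  apply: entry_split; have := congr1 (fun x : 'X_{1..m * n} => x (mxvec_index i l)) eq_v1.
  rewrite eq_v2 !mnmDE !mnm1E !inj_mxvec_index !xpair_eqE !eqxx [j == l]eq_sym (negPf lj).
  by rewrite andbF addn0 addn1 => <-.
have lS : l \notin S.
  by apply/negP => /vS; rewrite eq_v2 colsizeD colsizeU eqxx addn1.
have eq_v : (v + w = v3 + w + E i l + E k j)%MM by rewrite eq_v1 eq_v3; ac_mnm.
have /connectP[p pathp lastp] := b_conn _ _ lS jS bl.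
apply: mono_congr_trans (step (v3 + E k l)%MM _ _) _.
- by move=> c; rewrite eqC eq_v1 eq_v3 !colsizeD !colsizeU; lia.
- by move=> a c; rewrite eqR eq_v1 eq_v3 !rowsizeD !rowsizeU bl; lia.
rewrite eq_v; apply: mono_congr_sym.
have -> : (v3 + E k l + E i j + w = v3 + w + E k l + E i j)%MM by ac_mnm.
apply: mono_congr_path pathp lastp _ => c cS.
by rewrite -eq_v vw_full.
Qed.

(** The exponent of the image of X^u when no entry is killed: the t-exponents are the column
    degrees, the y-exponents the row contents. *)
Definition mono_weight b u : 'X_{1..m * n + n} :=
  (\sum_i \sum_j (U_(lshift n (mxvec_index i (b j))) + U_(rshift (m * n) j)) *+
     u (mxvec_index i j))%MM.

Lemma mono_weight_col b u j : mono_weight b u (rshift (m * n) j) = colsize u j.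
Proof.
rewrite mnm_sumE; apply: eq_bigr => i _; rewrite mnm_sumE (bigD1 j) //= big1 => [|l lj].
  by rewrite mulmnE mnmDE !mnm1E eq_lrshift eqxx mul1n addn0.
by rewrite mulmnE mnmDE !mnm1E eq_lrshift eq_rshift (negPf lj).
Qed.

Lemma mono_weight_row b u i c :
  mono_weight b u (lshift n (mxvec_index i c)) = rowsize b u i c.
Proof.
rewrite mnm_sumE (bigD1 i) //= [X in (_ + X)%N]big1 => [|k ki].
  rewrite addn0 mnm_sumE /rowsize [in RHS]big_mkcond /=; apply: eq_bigr => j _.
  rewrite mulmnE mnmDE !mnm1E eq_rlshift eq_lshift inj_mxvec_index xpair_eqE eqxx addn0.
  by rewrite mulnbl.
rewrite mnm_sumE big1 // => j _.
by rewrite mulmnE mnmDE !mnm1E eq_rlshift eq_lshift inj_mxvec_index xpair_eqE (negPf ki).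
Qed.

Lemma mono_weight_inj b u v :
  (mono_weight b u == mono_weight b v) =
  [forall j, colsize u j == colsize v j] &&
  [forall i, [forall c, rowsize b u i c == rowsize b v i c]].
Proof.
apply/eqP/andP => [uv|[/forallP eqC /forallP eqR]].
  split; apply/forallP => j; first by rewrite -!(mono_weight_col b) uv.
  by apply/forallP => c; rewrite -!mono_weight_row uv.
apply/mnmP => t; case: (splitP t) => [t' /esym tt'|j /esym tj].
  have -> : t = lshift n t' by apply/val_inj.
  by case/mxvec_indexP: t' {tt'} => i c; rewrite !mono_weight_row; apply/eqP/(forallP (eqR i)).
have -> : t = rshift (m * n) j by apply/val_inj.
by rewrite !mono_weight_col; apply/eqP.
Qed.

Definition avoids S u := [forall j in S, colsize u j == 0%N].

Lemma mmap1_comp_mx S b u :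
  mmap1 (fun_of_matrix (mxvec (comp_mx K m S b)) 0) u =
  if avoids S u then 'X_[mono_weight b u] else 0.
Proof.
rewrite /mmap1 (reindex _ (curry_mxvec_bij m n)) /=.
transitivity (\prod_i \prod_j comp_mx K m S b i j ^+ u (mxvec_index i j)).
  by rewrite pair_bigA /=; apply: eq_bigr => -[i j] _ /=; rewrite mxvecE.
case: ifP => [/forall_inP uS|/negbT].
  rewrite /mono_weight -mprodXE; apply: eq_bigr => i _.
  rewrite -mprodXE; apply: eq_bigr => j _; rewrite mxE -mpolyXn mpolyXD.
  case: ifP => // /uS; rewrite sum_nat_eq0 => /forallP/(_ i)/eqP ->.
  by rewrite !expr0.
rewrite negb_forall_in => /exists_inP[j jS]; rewrite sum_nat_eq0 negb_forall.
case/existsP=> i /= ui; rewrite (bigD1 i) //= (bigD1 j) //= mxE jS expr0n (negPf ui).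
by rewrite !mul0r.
Qed.

Lemma mcoeff_comp_mx S b (g : R) (x : 'X_{1..m * n + n}) :
  (specialize (comp_mx K m S b) g)@_x =
  \sum_(v <- msupp g | avoids S v && (mono_weight b v == x)) g@_v.
Proof.
rewrite [in RHS]big_mkcond /mmap raddf_sum; apply: eq_bigr => v _.
rewrite /= mcoeffCM mmap1_comp_mx; case: ifP => _ /=; last by rewrite mcoeff0 mulr0.
by rewrite mcoeffX; case: ifP; rewrite ?mulr1 ?mulr0.
Qed.

Definition empty_columns u : {set 'I_n} := [set j | colsize u j == 0%N].

(* For a monomial u, the membership of g in P_S with S the set of empty columns
   of u says that the coefficients of g in the class of u add up to zero. *)
Lemma binomial_edge_ideal_inter (b : {set 'I_n} -> 'I_n -> 'I_n) (g : R) :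
  (forall S j l, j \notin S -> l \notin S -> b S j = b S l -> connect (induced S) j l) ->
  (forall S, g \in comp_ideal K m S (b S)) -> g \in J.
Proof.
(* The empty columns belong to the key because the labels [b S] depend on them. *)
move=> b_conn gP; pose key u := (empty_columns u, mono_weight (b (empty_columns u)) u).
have [u|r [key_r ->]] := @sum_monomial_classes K _ _ key g.
  have /eqP := gP (empty_columns u).
  move/(congr1 (mcoeff (mono_weight (b (empty_columns u)) u))).
  rewrite mcoeff_comp_mx mcoeff0; apply: etrans; apply: eq_bigl => v.
  rewrite /key xpair_eqE; apply/andP/andP => [[/eqP uv weq]|[_ weq]].
    rewrite uv in weq; split=> //; rewrite -uv.
    by apply/forall_inP => j; rewrite inE.
  have -> : empty_columns v = empty_columns u.
    move: weq; rewrite mono_weight_inj => /andP[/forallP eqC _].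
    by apply/setP => j; rewrite !inE (eqP (eqC j)).
  by rewrite eqxx.
rewrite big_seq; apply: generated_ideal_sum => u /key_r[key1 key2].
rewrite -mul_mpolyC; apply: generated_idealMl.
(* The context starts out trivial: outside [S] all columns of u are nonempty already. *)
rewrite -[u in 'X_[u]]addm0 -[r u]addm0; set S := empty_columns u in key1 key2.
move: key2; rewrite key1 => /eqP; rewrite mono_weight_inj.
move=> /andP[/forallP eqC /forallP eqR].
apply: (@mono_congr_comp S (b S)) => [||j|j|i c]; first exact: b_conn.
- by move=> j; rewrite inE => /eqP.
- by rewrite addm0 inE.
- by rewrite (eqP (eqC j)).
by rewrite (eqP (forallP (eqR i) c)).
Qed.

End BinomialEdgeIdealOfCompleteGraph.

Lemma connect_invariant (T : finType) (A : Type) (e : rel T) (f : T -> A) x y :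
  (forall x y, e x y -> f x = f y) -> connect e x y -> f x = f y.
Proof.
move=> fe /connectP[p]; elim: p x => [|z p IHp] x /=; first by move=> _ ->.
by move=> /andP[/fe -> /IHp zy] /zy.
Qed.

(** * Associated primes and cut sets *)

Section AssociatedPrimes.
Local Open Scope ring_scope.
Variables (K : fieldType) (m n : nat) (G : rel 'I_n).
Hypotheses (G_sym : ssrbool.symmetric G) (G_irr : irreflexive G).
Local Notation X := (indet_mx K m n).
Local Notation J := (binomial_edge_ideal K (complete_graph m) G).
Implicit Types S : {set 'I_n}.

Lemma induced_connect_sym S : connect_sym (induced G S).
Proof. by apply: sym_connect_sym => x y; rewrite /induced G_sym andbCA. Qed.

Definition comp_root S : 'I_n -> 'I_n := fingraph.root (induced G S).

Lemma comp_root_eq S x y : (comp_root S x == comp_root S y) = connect (induced G S) x y.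
Proof. exact: root_connect (induced_connect_sym S) x y. Qed.

Lemma comp_root_notin S j : j \notin S -> comp_root S j \notin S.
Proof.
move=> jS; rewrite /comp_root.
rewrite -(connect_invariant (f := fun x => x \in S) _ (connect_root _ j)) // => x y.
by move=> /and3P[/negPf -> /negPf ->].
Qed.

Lemma comp_root_idem S j : comp_root S (comp_root S j) = comp_root S j.
Proof. exact: fingraph.root_root (induced_connect_sym S) j. Qed.

Definition vertex_prime S := comp_ideal K m S (comp_root S).

Lemma prime_vertex_prime S : prime_ideal (vertex_prime S).
Proof. exact: prime_comp_ideal. Qed.

Lemma binomial_edge_idealP (g : {mpoly K[m * n]}) :
  reflect (forall S, g \in vertex_prime S) (g \in J).
Proof.
apply: (iffP idP) => [gJ S|].
  apply: binomial_edge_ideal_sub gJ => j l jS lS Gjl.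
  by apply/eqP; rewrite comp_root_eq connect1 // /induced jS lS.
apply: binomial_edge_ideal_inter => // S j l _ _ /eqP.
by rewrite comp_root_eq.
Qed.

Definition cut_pair S s (p : 'I_n * 'I_n) :=
  [&& p.1 \notin S, p.2 \notin S, G s p.1, G s p.2 & ~~ connect (induced G S) p.1 p.2].

(** The cut point property: putting back any s merges components. The empty set has it vacuously. *)
Definition cutset S := [forall s in S, [exists p, cut_pair S s p]].

(** If s is no cut point, its neighbours outside [S] lie in one component, so restoring s joins no
    two components. *)
Lemma vertex_prime_remove S s : s \in S -> ~~ [exists p, cut_pair S s p] ->
  {subset vertex_prime (S :\ s) <= vertex_prime S}.
Proof.
rewrite negb_exists => sS /forallP nocut.
have nbrs a c : a \notin S -> c \notin S -> G s a -> G s c ->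
    comp_root S a = comp_root S c.
  move=> aS cS Ga Gc; apply/eqP; rewrite comp_root_eq.
  by have := nocut (a, c); rewrite /cut_pair aS cS Ga Gc negbK.
apply: comp_ideal_sub; first exact: subsetDl.
(* [f] puts s into the component of its neighbours. If there are none, s is isolated and its value
   is never compared. *)
pose f x := if x != s then comp_root S x else
  if [pick a | (a \notin S) && G s a] is Some a then comp_root S a else x.
have fs y : y \notin S -> G s y -> f s = comp_root S y.
  rewrite /f eqxx => yS Gy; case: pickP => [a /andP[aS Ga]|/(_ y)]; first exact: nbrs.
  by rewrite yS Gy.
move=> j l jS lS /eqP; rewrite comp_root_eq => conn_jl.
have neq x : x \notin S -> x != s by apply: contraNneq => ->.
suff: f j = f l by rewrite /f !neq.
apply: connect_invariant conn_jl => x y; rewrite /induced !in_setD1 => /and3P[].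
have [-> _|xs /= xS] := eqVneq x s.
  have [->|ys /= yS Gy] := eqVneq y s; first by rewrite G_irr.
  by rewrite (fs y) // /f ys.
have [-> _|ys /= yS] := eqVneq y s.
  by rewrite G_sym => Gx; rewrite (fs x) // /f xs.
move=> Gxy; rewrite /f xs ys; apply/eqP.
by rewrite comp_root_eq connect1 // /induced xS yS.
Qed.

(** Let P = (J : f). If f is not in P_S, then P lies in P_S; by primality some such P_S also lies in
    P. Removing points that are not cut points preserves both facts and ends with a cut set. *)
Lemma associated_prime_cutset (P : {pred {mpoly K[m * n]}}) :
  associated_prime J P -> exists2 S, cutset S & P =i vertex_prime S.
Proof.
move=> [prP [f Pf]]; have [idlP _] := prP.
have sub S : f \notin vertex_prime S -> {subset P <= vertex_prime S}.
  move=> fS g; rewrite Pf => /binomial_edge_idealP/(_ S).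
  by rewrite prime_idealM ?(negPf fS) ?orbF //; apply: prime_vertex_prime.
have [S [fS SP]] : exists S, f \notin vertex_prime S /\ {subset vertex_prime S <= P}.
  apply: contrapT => noS.
  have g_ex S : exists g, (f \notin vertex_prime S) ==> (g \in vertex_prime S) && (g \notin P).
    have [fS|fS] := boolP (f \in vertex_prime S); first by exists 0.
    apply: contrapT => nog; apply: noS; exists S; split=> // g gS.
    by apply: contrapT => /negP gP; apply: nog; exists g; rewrite /= gS gP.
  have [g gP] := choice g_ex.
  (* This product of elements outside P would annihilate f modulo J, since each P_S contains f or a
     factor. *)
  have : \prod_(S | f \notin vertex_prime S) g S \notin P.
    by apply: prime_ideal_prod => // S fS; have := gP S; rewrite fS => /andP[].
  case/negP; rewrite Pf; apply/binomial_edge_idealP => S.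
  have prS := prime_vertex_prime S; rewrite prime_idealM //.
  apply/orP; have /orP[fS|fS] := orbN (f \in vertex_prime S); [by right|left].
  rewrite (bigD1 S) //= prime_idealM //.
  by have /implyP/(_ fS)/andP[gS _] := gP S; apply/orP; left.
have [d] := ubnP #|S|; elim: d => // d IHd in S fS SP *; rewrite ltnS => leSd.
have [|/forall_inPn[s sS nocut]] := boolP (cutset S).
  by exists S => // g; apply/idP/idP; [apply: sub|apply: SP].
have rem := vertex_prime_remove sS nocut.
apply: (IHd (S :\ s)).
- by apply: contra fS; apply: rem.
- by move=> g /rem/SP.
by rewrite (cardsD1 s) sS in leSd.
Qed.

(** P_S = (J : f) for a product f outside P_S that lies in every other P_S'. The variables handle S'
    not inside [S]. The minors on cut pairs handle S' properly inside [S], where a point s of [S]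
    outside S' connects its two neighbours. *)
Lemma associated_prime_vertex_prime (i0 i1 : 'I_m) S : i0 != i1 -> cutset S ->
  associated_prime J (vertex_prime S).
Proof.
move=> i01 /forall_inP cutS; split; first exact: prime_vertex_prime.
have p_ex s : exists p, (s \in S) ==> cut_pair S s p.
  have [/cutS/existsP[p sp]|_] := boolP (s \in S); first by exists p.
  by exists (s, s).
have [p p_cut] := choice p_ex.
pose minor s := X i0 (p s).1 * X i1 (p s).2 - X i0 (p s).2 * X i1 (p s).1.
pose f := (\prod_(j | j \notin S) X i0 j) * \prod_(s in S) minor s.
have minor_notin s : s \in S -> minor s \notin vertex_prime S.
  move=> sS; have /and5P[aS cS _ _] : cut_pair S s (p s) by have := p_cut s; rewrite sS.
  rewrite -comp_root_eq => rac; rewrite morph_kernelE rmorphB !rmorphM /= !specializeX.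
  rewrite !mxE (negPf aS) (negPf cS) /yvar /tvar -!mpolyXD subr_eq0.
  (* The variable y_(i0,c), with c the component of the first neighbour, divides only one of the two
     monomials. *)
  apply/eqP => /mpolyX_inj/(congr1 (fun u : 'X_{1..m * n + n} =>
    u (lshift n (mxvec_index i0 (comp_root S (p s).1))))).
  rewrite !mnmDE !mnm1E !eq_rlshift !eq_lshift !inj_mxvec_index !xpair_eqE !eqxx.
  by rewrite [i1 == i0]eq_sym (negPf i01) [_ == comp_root S _]eq_sym (negPf rac).
have fS : f \notin vertex_prime S.
  have prS := prime_vertex_prime S.
  rewrite prime_idealM // negb_or !prime_ideal_prod // => j jS.
  by rewrite comp_ideal_var.
exists f => g; apply/idP/idP => [gS|/binomial_edge_idealP/(_ S)]; last first.
  by rewrite prime_idealM ?(negPf fS) ?orbF //; apply: prime_vertex_prime.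
apply/binomial_edge_idealP => S'; have prS' := prime_vertex_prime S'.
rewrite prime_idealM //; apply/orP; have [eqS|neqS] := eqVneq S' S.
  by left; rewrite eqS.
right; have [subS|/subsetPn[j jS' jS]] := boolP (S' \subset S); last first.
  have Xj : X i0 j \in vertex_prime S' by rewrite comp_ideal_var.
  rewrite /f prime_idealM //; apply/orP; left.
  by rewrite (bigD1 j jS) (prime_idealM _ _ prS'); apply/orP; left.
have /properP[_ [s sS sS']] : S' \proper S by rewrite properEneq neqS.
rewrite /f prime_idealM //; apply/orP; right.
rewrite (bigD1 s sS) (prime_idealM _ _ prS'); apply/orP; left.
have /and5P[aS cS Ga Gc _] : cut_pair S s (p s) by have := p_cut s; rewrite sS.
have notS' x : x \notin S -> x \notin S' by apply/contra/(subsetP subS).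
apply: comp_ideal_minor => aS' cS'; apply/eqP; rewrite comp_root_eq.
apply: (connect_trans (y := s)); apply: connect1; rewrite /induced sS' notS' //=.
by rewrite G_sym.
Qed.

End AssociatedPrimes.

Arguments vertex_prime K m {n} G S.

(** * Heights in terms of components *)

Section HeightOfVertexPrimes.
Variables (K : fieldType) (m n : nat) (G : rel 'I_n).
Hypothesis G_sym : ssrbool.symmetric G.
Implicit Types S : {set 'I_n}.

(** One vertex per component; vertices of [S] are isolated and their own roots, hence excluded
    explicitly. *)
Definition comp_reprs S : {set 'I_n} :=
  [set j | (j \notin S) && (comp_root G S j == j)].

Lemma card_free_entries (i0 : 'I_m) S :
  #|free_entries i0 S (comp_root G S)| = (n - #|S| + m.-1 * #|comp_reprs S|)%N.
Proof.
(* Row [i0] contributes n - |S| entries, every other row one per component. *)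
have -> : free_entries i0 S (comp_root G S) =
    setX [set i0] (~: S) :|: setX [set~ i0] (comp_reprs S).
  by apply/setP => -[i j]; rewrite !inE /=; case: (i == i0); case: (j \in S);
    rewrite ?orbF ?andbF.
rewrite cardsU !cardsX cards1 mul1n cardsC1 card_ord [in X in (_ - X)%N](_ : _ :&: _ = set0).
  by rewrite cards0 subn0 -[n in (n - _)%N]card_ord -(cardsC S) addKn.
by apply/setP => -[i j]; rewrite !inE; case: (i == i0); rewrite ?andbF.
Qed.

Lemma has_height_vertex_prime S : 0 < m ->
  exists2 h, has_height (vertex_prime K m G S) h &
    h + (n - #|S| + m.-1 * #|comp_reprs S|) = m * n.
Proof.
move=> m_gt0; pose i0 := Ordinal m_gt0.
exists #|~: free_entries i0 S (comp_root G S)|.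
  apply: has_height_comp_ideal => j jS; first exact: comp_root_notin.
  exact: comp_root_idem.
by rewrite -(card_free_entries i0) addnC cardsC card_prod !card_ord.
Qed.

Lemma comp_reprs_cutset S : S != set0 -> cutset G S -> 1 < #|comp_reprs S|.
Proof.
move=> /set0Pn[s sS] /forall_inP/(_ s sS)/existsP[[a c] /and5P[/= aS cS _ _]].
rewrite -comp_root_eq // => ac; apply/card_gt1P.
exists (comp_root G S a), (comp_root G S c).
by rewrite !inE !comp_root_notin // !comp_root_idem // !eqxx.
Qed.

End HeightOfVertexPrimes.

(** * Cut sets of cycles *)

Section Cycles.
Variable n : nat.
Hypothesis n_ge3 : 2 < n.
Local Notation C := (cycle_graph n).
Implicit Types S : {set 'I_n}.

Lemma val_ordS (i : 'I_n) : ordS i = (if i.+1 == n then 0 else i.+1) :> nat.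
Proof.
rewrite /=; case: eqP => [->|]; first by rewrite modnn.
by move/eqP => ni; rewrite modn_small // ltn_neqAle ni ltn_ord.
Qed.

Lemma cycle_graph_sym : ssrbool.symmetric C.
Proof. by move=> i j; rewrite /cycle_graph orbC. Qed.

Lemma cycle_graph_irr : irreflexive C.
Proof.
move=> i; rewrite /cycle_graph orbb -val_eqE [val (ordS i)]val_ordS /=.
by case: ifP; lia.
Qed.

Lemma cycle_graphE (i j : 'I_n) : C i j =
  [|| j == i.+1 :> nat, i == j.+1 :> nat, (i.+1 == n) && (j == 0 :> nat)
    | (j.+1 == n) && (i == 0 :> nat)].
Proof.
rewrite /cycle_graph -!val_eqE [val (ordS i)]val_ordS [val (ordS j)]val_ordS /=.
by have := ltn_ord i; have := ltn_ord j; case: ifP; case: ifP; lia.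
Qed.

Lemma iter_ordS (i j : 'I_n) : exists k, j = iter k (@ordS n) i.
Proof.
have val_iter k : iter k (@ordS n) i = (i + k) %% n :> nat.
  elim: k => [|k IHk]; first by rewrite addn0 modn_small.
  by rewrite iterS /= IHk -addn1 modnDml addn1 addnS.
exists (n - i + j); apply/val_inj; rewrite /= val_iter addnA subnKC 1?ltnW //.
by rewrite modnDl modn_small.
Qed.

Lemma card_comp_reprs0 : #|comp_reprs C set0| = 1.
Proof.
pose i0 : 'I_n := Ordinal (ltnW (ltnW n_ge3)).
have root_eq j : comp_root C set0 j = comp_root C set0 i0.
  have [k ->] := iter_ordS i0 j; elim: k => //= k <-; apply/esym/eqP.
  rewrite comp_root_eq; last exact: cycle_graph_sym.
  by rewrite connect1 // /induced !inE /cycle_graph eqxx.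
rewrite -(cards1 (comp_root C set0 i0)); congr #|pred_of_set _|.
by apply/setP => j; rewrite !inE root_eq eq_sym /=.
Qed.

(** Walk backwards from j until the first vertex s of [S]; the walk down to [ordS s] stays outside
    [S]. *)
Lemma connect_walk_back S (j : 'I_n) : S != set0 -> j \notin S ->
  exists2 s, s \in S & connect (induced C S) j (ordS s).
Proof.
case/set0Pn => s0 s0S; have [k ->] := iter_ordS s0 j; elim: k => [|k IHk]; first by rewrite s0S.
rewrite iterS; set i := iter k _ s0 in IHk * => iS.
have [iS'|/[dup] iS' /IHk[s sS i_s]] := boolP (i \in S); first by exists i.
exists s => //; apply: connect_trans i_s; apply: connect1.
by rewrite /induced iS iS' /cycle_graph eqxx orbT.
Qed.

(** Each component contains the successor of a point of [S]. *)
Lemma card_comp_reprs_le S : S != set0 -> #|comp_reprs C S| <= #|S|.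
Proof.
move=> S0; pose f s := comp_root C S (ordS s).
suff /subset_leq_card/leq_trans : comp_reprs C S \subset f @: S.
  by apply; apply: leq_imset_card.
apply/subsetP => j; rewrite inE => /andP[jS /eqP root_j].
have [s sS js] := connect_walk_back S0 jS.
apply/imsetP; exists s => //; rewrite /f -{1}root_j; apply/eqP.
by rewrite comp_root_eq //; apply: cycle_graph_sym.
Qed.

(** If the successor of s were in [S], both members of a cut pair would be the predecessor of s. *)
Lemma cutset_cycle_indep S s : cutset C S -> s \in S -> ordS s \notin S.
Proof.
move=> /forall_inP/(_ s)/[apply]/existsP[[a c] /and5P[/= aS cS]].
rewrite /cycle_graph => Ga Gc; apply: contra => sS.
have eqs x : x \notin S -> (x == ordS s) || (s == ordS x) -> s = ordS x.
  by move=> xS /orP[/eqP xs|/eqP //]; rewrite xs sS in xS.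
have -> : a = c by apply: ordS_inj; rewrite -(eqs a) // -(eqs c).
exact: connect0.
Qed.

Lemma card_cutset_cycle S : cutset C S -> (#|S|).*2 <= n.
Proof.
move=> cutS; rewrite -addnn -{2}(card_imset S (@ordS_inj n)).
rewrite -cardsUI [X in (_ + X)%N](_ : _ = 0) ?addn0.
  by rewrite -[X in _ <= X]card_ord max_card.
apply/eqP; rewrite cards_eq0; apply/eqP/setP => j; rewrite !inE.
apply/negP => /andP[jS /imsetP[s sS js]].
by have := cutset_cycle_indep cutS sS; rewrite -js jS.
Qed.

(** A vertex whose neighbours all lie in [S] is a component by itself. *)
Lemma cut_pair_isolated S s (o p : 'I_n) :
  o \notin S -> p \notin S -> o != p -> C s o -> C s p ->
  (forall j, C o j -> j \in S) -> cut_pair C S s (o, p).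
Proof.
move=> oS pS op so sp o_isol; rewrite /cut_pair /= oS pS so sp /=.
apply/negP => /(connect_invariant (f := pred1 o)) /= inv; move/negP: op; apply.
rewrite eq_sym -inv ?eqxx // => x y /and3P[xS yS xy].
have [xo|_] := eqVneq x o; first by rewrite xo in xy; rewrite o_isol in yS.
by apply/esym/negP => /eqP yo; rewrite cycle_graph_sym yo in xy; rewrite o_isol in xS.
Qed.

Definition even_below k : {set 'I_n} := [set j : 'I_n | (j < k.*2) && ~~ odd j].

Lemma card_even_below k : k.*2 <= n -> #|even_below k| = k.
Proof.
move=> k_le; have lt_k (a : 'I_k) : a.*2 < n by have := ltn_ord a; lia.
have -> : even_below k = [set Ordinal (lt_k a) | a : 'I_k].
  apply/setP => j; rewrite inE; apply/idP/imsetP => [/andP[jk oj]|[a _ ->]].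
    have hj : j./2 < k by lia.
    by exists (Ordinal hj) => //; apply/val_inj => /=; lia.
  by rewrite /= ltn_double ltn_ord odd_double.
rewrite card_imset ?card_ord // => a a' /(congr1 val) /= /double_inj.
exact: val_inj.
Qed.

Lemma cutset_even_below k : 1 < k -> k.*2 <= n -> cutset C (even_below k).
Proof.
move=> k_gt1 k_le; apply/forall_inP => s; rewrite inE => /andP[sk so].
have [sk'|sk'] := ltnP s.+2 k.*2.
  (* Unless s is the largest element, s + 1 has both neighbours in the set; the other witness is the
     cyclic predecessor of s. *)
  have o_lt : s.+1 < n by lia.
  have p_lt : (if s == 0 :> nat then n.-1 else s.-1) < n by case: ifP; lia.
  apply/existsP; exists (Ordinal o_lt, Ordinal p_lt).
  apply: cut_pair_isolated; rewrite ?inE ?cycle_graphE -?val_eqE /=; try (case: ifP; lia); try lia.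
  by move=> j; rewrite inE cycle_graphE /=; have := ltn_ord j; lia.
(* For s = 2k - 2 the isolated vertex is s - 1; its other neighbour s - 2 is in the set since k >
   1. *)
have o_lt : s.-1 < n by lia.
have p_lt : (if s.+1 == n then 0 else s.+1) < n by case: ifP; lia.
apply/existsP; exists (Ordinal o_lt, Ordinal p_lt).
apply: cut_pair_isolated; rewrite ?inE ?cycle_graphE -?val_eqE /=; try (case: ifP; lia); try lia.
by move=> j; rewrite inE cycle_graphE /=; have := ltn_ord j; lia.
Qed.

End Cycles.

(** * Unmixedness for cycles *)

Section UnmixednessForCycles.
Variables (K : fieldType) (m n : nat).
Hypotheses (m_ge2 : 1 < m) (n_ge3 : 2 < n).
Local Notation J := (binomial_edge_ideal K (complete_graph m) (cycle_graph n)).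

(** For a cut set S of size k with c components, equal heights of P_{} and P_S mean n + (m - 1) = n
    - k + (m - 1) c. *)
Lemma unmixed_cycle_eq k : unmixed J -> 1 < k -> k.*2 <= n ->
  exists2 c, 1 < c & m.-1 * c.-1 = k.
Proof.
move=> unm k_gt1 k_le; pose S := even_below n k.
have G_sym := @cycle_graph_sym n; have G_irr := cycle_graph_irr n_ge3.
have m_gt0 : 0 < m by apply: ltnW.
have assoc S' : cutset (cycle_graph n) S' ->
    associated_prime J (vertex_prime K m (cycle_graph n) S').
  exact: (associated_prime_vertex_prime K G_sym G_irr
    (i0 := Ordinal m_gt0) (i1 := Ordinal m_ge2)).
have cut0 : cutset (cycle_graph n) set0 by apply/forall_inP => s; rewrite inE.
have cutS : cutset (cycle_graph n) S by apply: cutset_even_below.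
have cardS : #|S| = k by apply: card_even_below.
have S0 : S != set0 by rewrite -card_gt0 cardS ltnW.
exists #|comp_reprs (cycle_graph n) S|; first exact: comp_reprs_cutset.
have [h0 ht0] := has_height_vertex_prime K G_sym set0 m_gt0.
have [h1 ht1] := has_height_vertex_prime K G_sym S m_gt0.
rewrite card_comp_reprs0 // cards0 cardS.
have -> := has_height_unique (unm _ _ (assoc _ cut0) (assoc _ cutS) _ ht0) ht1.
have := comp_reprs_cutset G_sym S0 cutS; move: #|_| => c.
by case: m m_ge2 => [|[|m']] // _; case: c => [|c] //=; nia.
Qed.

(** The constant n + 2 is n - |S| + 2 c(S) in all cases: c = 1 for the empty set, and otherwise 2 <=
    c <= |S| <= n / 2 < 3 forces c = |S| = 2. *)
Lemma height_associated_prime_cycle P : m = 3 -> n <= 5 ->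
  associated_prime J P -> exists2 h, has_height P h & h + (n + 2) = m * n.
Proof.
move=> m3 n_le5; have G_sym := @cycle_graph_sym n.
move=> /(associated_prime_cutset G_sym (cycle_graph_irr n_ge3))[S cutS eqP].
have [h htS ht_eq] := has_height_vertex_prime K G_sym S (ltnW m_ge2).
exists h; first by apply: eq_has_height htS => g; rewrite eqP.
rewrite -ht_eq m3 /=; congr (_ + _).
have [->|S0] := eqVneq S set0; first by rewrite cards0 card_comp_reprs0 // muln1 subn0.
have := comp_reprs_cutset G_sym S0 cutS; have := card_comp_reprs_le S0.
have := card_cutset_cycle cutS; move: #|comp_reprs _ _| #|S| => c s. lia.
Qed.

End UnmixednessForCycles.

Theorem proposition4p2 (K : fieldType) (m n : nat) (hm : 3 <= m) (hmn : m <= n) :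
  unmixed (binomial_edge_ideal K (complete_graph m) (cycle_graph n)) <->
  (m = 3 /\ n = 3) \/ (n = 4 /\ m = 3) \/ (n = 5 /\ m = 3).
Proof.
have m_ge2 := ltnW hm; have n_ge3 := leq_trans hm hmn.
split=> [unm|mn].
  have eq_k := unmixed_cycle_eq m_ge2 n_ge3 unm.
  have [n_lt4|n_ge4] := ltnP n 4; first by lia.
  (* With |S| = 2, the equation makes m - 1 a divisor of 2. *)
  have [c c_gt1 mc] := eq_k 2 isT n_ge4.
  have m_le3 : m.-1 <= 2 by rewrite -mc leq_pmulr //; lia.
  have m3 : m = 3 by lia.
  have [n_lt6|n_ge6] := ltnP n 6; first by lia.
  (* With |S| = 3 and m = 3 the equation 2 (c - 1) = 3 fails by parity. *)
  by have [c' _] := eq_k 3 isT n_ge6; rewrite m3 /=; lia.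
have [m3 n_le5] : m = 3 /\ n <= 5 by lia.
move=> P Q aP aQ h htP.
have [hP ht_hP eqP] := height_associated_prime_cycle m_ge2 n_ge3 m3 n_le5 aP.
have [hQ ht_hQ eqQ] := height_associated_prime_cycle m_ge2 n_ge3 m3 n_le5 aQ.
rewrite (has_height_unique htP ht_hP).
by have -> : hP = hQ by lia.
Qed.
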